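(* For all $k\in\mathbb{N}$ there exist forms $p\in P_{3,4k+6}$ such that $pq$ is not a sum of squares for all nonzero $q\in\Sigma_{3,2k}$. There exist forms $p\in P_{4,6}$ such that $pq$ is not a sum of squares for all nonzero $q\in\Sigma_{4,2}$, and there exist forms $p\in P_{7,4}$ such that $pq$ is not a sum of squares for all nonzero $q\in\Sigma_{7,2}$.
   Context: $P_{n,2d}$ is the cone of real forms of degree $2d$ in $n$ variables that are nonnegative on $\mathbb{R}^n$; $\Sigma_{n,2d}$ is the cone of forms of degree $2d$ in $n$ real variables that are sums of squares of real forms of degree $d$. *)

(* Defs.v *)
From HB Require Import structures.
From mathcomp Require Import all_boot all_order all_algebra.
From mathcomp Require Import reals.
From mathcomp Require Import mpoly.

Set Implicit Arguments.
Unset Strict Implicit.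
Unset Printing Implicit Defensive.

Import Order.TTheory GRing.Theory Num.Theory.
Local Open Scope ring_scope.

(* The parameter [d] is half the degree: [nonneg_form d] and [sos_form d] on
   [{mpoly R[n]}] are the cones P_{n,2d} and Sigma_{n,2d}.  As usual for such
   cones, [_.-homog] contains the zero polynomial. *)

Definition nonneg_form (R : realType) (n d : nat) (p : {mpoly R[n]}) : Prop :=
  p \is (2 * d)%N.-homog /\ forall x : 'I_n -> R, 0 <= p.@[x].

Definition sos_form (R : realType) (n d : nat) (p : {mpoly R[n]}) : Prop :=
  p \is (2 * d)%N.-homog /\
  exists (m : nat) (f : 'I_m -> {mpoly R[n]}),
    (forall i, f i \is d.-homog) /\ p = \sum_(i < m) f i ^+ 2.

(* Squares of arbitrary polynomials are allowed; when [p] is a form of degree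
   2d this is equivalent to [sos_form d p], because no cancellation can occur
   in the extreme homogeneous parts of a sum of real squares. *)
Definition is_sos (R : realType) (n : nat) (p : {mpoly R[n]}) : Prop :=
  exists (m : nat) (f : 'I_m -> {mpoly R[n]}), p = \sum_(i < m) f i ^+ 2.

(* Main.v *)
(** Idea.  Let [A] be a set of [m] variables and [z] a further one, set [z = 1],
    and consider on the grid [{0, .., N-1}^A] the simplex [V] of points with
    coordinate sum at most [k] and its complement [S], where
    [N + 2k < m (N - 1) <= 2N + k].  Finite differences of order larger than the
    degree vanish.  Over the boxes from [v] in [V] to [(N-1, .., N-1)] this (a
    Cayley-Bacharach relation) expresses [f v], for [deg f <= N + k], through the
    values of [f] on [S]; over the boxes from [0] to [y] it expresses the value at
    a lattice point [y] of a polynomial of degree at most [k] through its values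
    on [V].  The form
      [M sum_A prod_(j < N) (x_i - j z)^2 + prod_(j < 2N) (t - (k+1+j) z) + eps z^2N],
    with [t = sum_A x_i], equals [eps] on [S] and is at least 1 on [V], and it is
    nonnegative when [M] is large.  If [p q = sum f_i^2] then, with constants
    independent of [eps],
      [sum_V q <= sum_V p q <= C1 sum_S p q = C1 eps sum_S q <= C1 C2 eps sum_V q],
    so for small [eps] the form [q] vanishes on [V], hence at all lattice points,
    and [q = 0]. *)

Require Import Defs.
From HB Require Import structures.
From mathcomp Require Import all_boot all_order all_algebra.
From mathcomp Require Import reals.
From mathcomp Require Import mpoly.
From mathcomp Require Import zify lra ring.

Import Order.TTheory GRing.Theory Num.Theory.
Local Open Scope ring_scope.

(** * Finite differences of polynomials at lattice points *)

Section FiniteDifferences.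

Variable R : realType.

(* The [a]-th finite difference of the function [x ^+ e], up to the sign
   [(-1) ^+ a]; any bound [K > a] on the summation gives the same value. *)
Definition diffX (K a e : nat) (x : R) : R :=
  \sum_(j < K) (-1) ^+ j * 'C(a, j)%:R * (x + j%:R) ^+ e.

Lemma diffX0 (K a : nat) (x : R) : (a < K)%N -> diffX K a 0 x = (a == 0%N)%:R.
Proof.
move=> aK; rewrite /diffX.
have -> : (a == 0)%N%:R = (1 - 1 : R) ^+ a by rewrite subrr expr0n.
rewrite exprBn.
rewrite (big_ord_widen K (fun j => (-1) ^+ j * 1 ^+ (a - j) * 1 ^+ j *+ 'C(a, j) : R)) //.
rewrite [RHS]big_mkcond /=; apply: eq_bigr => j _.
rewrite expr0 !expr1n !mulr1 ltnS mulr_natr; case: leqP => // /bin_small ->.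
by rewrite mulr0n.
Qed.

(** Split off one factor [x + j]. The part with [j] is absorbed by
    [j * 'C(a.+1, j) = a.+1 * 'C(a, j.-1)]; shifting the index then moves [x] to [x + 1] and flips
    the sign. *)
Lemma diffXS (K a e : nat) (x : R) :
  diffX K.+1 a.+1 e.+1 x = x * diffX K.+1 a.+1 e x - a.+1%:R * diffX K a e (x + 1).
Proof.
rewrite /diffX mulr_sumr [\sum_(j < K.+1) x * _]big_ord_recl big_ord_recl.
rewrite mulr_sumr -addrA -sumrB; congr (_ + _).
  by rewrite exprS /= addr0; ring.
apply: eq_bigr => j _; rewrite lift0.
rewrite -[j.+1%:R]natr1 -addrA [1 + _]addrC.
have -> : (a.+1%:R * ((-1) ^+ j * 'C(a, j)%:R * (x + (j%:R + 1)) ^+ e) : R) =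
   (-1) ^+ j * ((j%:R + 1) * 'C(a.+1, j.+1)%:R) * (x + (j%:R + 1)) ^+ e.
  by rewrite natr1 -natrM -mul_bin_diag natrM; ring.
by rewrite !exprS; ring.
Qed.

Lemma diffX_eq0 (K a e : nat) (x : R) : (e < a < K)%N -> diffX K a e x = 0.
Proof.
elim: e a K x => [|e IHe] [|a] [|K] x //; try by rewrite andbF.
  by move=> aK; rewrite diffX0.
by move=> ?; rewrite diffXS !IHe ?mulr0 ?subr0 //; lia.
Qed.

Lemma diffXn (K a : nat) (x : R) : (a < K)%N -> diffX K a a x = (-1) ^+ a * a`!%:R.
Proof.
elim: a K x => [|a IHa] [|K] x // aK; first by rewrite diffX0 // mulr1.
by rewrite diffXS diffX_eq0 ?ltnSn // mulr0 sub0r IHa // exprS factS natrM; ring.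
Qed.

Variable n : nat.
Implicit Types (f : {mpoly R[n]}) (a y : 'I_n -> nat).

Definition evn f y : R := f.@[fun i => (y i)%:R].

Lemma evn_ext f y y' : y =1 y' -> evn f y = evn f y'.
Proof. by move=> yy'; apply: meval_eq => i; rewrite yy'. Qed.

(** Coefficients of the mixed difference of order [a i] in direction [i], up to a global sign. The
    common bound [K] gives a finite index type; the binomials vanish unless [b i <= a i]
    everywhere. *)
Definition fdcoef {K : nat} a (b : {ffun 'I_n -> 'I_K}) : R :=
  \prod_i ((-1) ^+ b i * 'C(a i, b i)%:R).

Lemma fdcoef_neq0 K a (b : {ffun 'I_n -> 'I_K}) :
  (fdcoef a b != 0) = [forall i, (b i <= a i)%N].
Proof.
apply/idP/forallP => [nz i|le].
  apply: contraR nz; rewrite -ltnNge => lt.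
  by rewrite /fdcoef (bigD1 i) //= bin_small // mulr0 mul0r.
apply/prodf_neq0 => i _.
by rewrite mulf_neq0 ?signr_eq0 // pnatr_eq0 -lt0n bin_gt0.
Qed.

(** On each monomial the sum over the box factors, by distributivity, into one-variable
    differences. *)
Lemma fd_expand K a f y :
  \sum_(b : {ffun 'I_n -> 'I_K}) fdcoef a b * evn f (fun i => y i + b i)%N =
  \sum_(m <- msupp f) f@_m * \prod_i diffX K (a i) (m i) (y i)%:R.
Proof.
under eq_bigr do rewrite /evn mevalE mulr_sumr.
rewrite exchange_big; apply: eq_bigr => m _ /=.
rewrite /diffX bigA_distr_bigA mulr_sumr; apply: eq_bigr => b _.
rewrite /fdcoef mulrCA -big_split; congr (_ * _).
by apply: eq_bigr => i _ /=; rewrite natrD.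
Qed.

(** A monomial of degree below the total order has an exponent [m i < a i], and the factor in that
    direction vanishes. *)
Lemma fd_eq0 K a f y : (forall i, a i < K)%N -> (msize f <= \sum_i a i)%N ->
  \sum_(b : {ffun 'I_n -> 'I_K}) fdcoef a b * evn f (fun i => y i + b i)%N = 0.
Proof.
move=> aK fa; rewrite fd_expand big_seq big1 // => m mf.
have [i lt] : exists i, (m i < a i)%N.
  apply/existsP; apply: contraTT (msize_mdeg_lt mf) => /existsPn ge.
  rewrite -leqNgt (leq_trans fa) // mdegE leq_sum // => i _.
  by rewrite leqNgt ge.
by rewrite (bigD1 i) //= diffX_eq0 ?lt ?aK // mul0r mulr0.
Qed.

(* The coefficients of [q] are recovered one after the other, by increasing
   degree in ['X_z], as finite differences at the origin of [q] on [y z = 1]. *)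
Lemma homog_evn_eq0 d (q : {mpoly R[n]}) (z : 'I_n) : q \is d.-homog ->
  (forall y, y z = 1%N -> evn q y = 0) -> q = 0.
Proof.
move=> /dhomogP qd q0; apply/mpolyP => m; rewrite mcoeff0.
have [l] := ubnP (m z); elim: l m => // l IHl m ml.
apply/eqP; apply: contraT => nz.
have md : mdeg m = d by apply: qd; rewrite mcoeff_msupp.
pose a i := if i == z then 0%N else m i; pose y i := nat_of_bool (i == z).
have aK i : (a i < d.+1)%N.
  by rewrite /a; case: eqP => // _; rewrite ltnS -md mdegE (bigD1 i) //= leq_addr.
have := fd_expand d.+1 a q y.
rewrite big1 => [|b _]; last first.
  have [->|] := eqVneq (fdcoef a b) 0; first by rewrite mul0r.
  rewrite fdcoef_neq0 => /forallP/(_ z); rewrite /a eqxx leqn0 => /eqP bz.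
  by rewrite q0 ?mulr0 // /y eqxx bz.
rewrite (bigD1_seq m) ?msupp_uniq ?mcoeff_msupp //= [X in _ + X]big_seq_cond.
rewrite [X in _ + X]big1 ?addr0.
  move/esym/eqP; rewrite mulf_eq0 (negPf nz) prodf_seq_eq0 => /hasP[i _] /=.
  rewrite /y /a; have [iz|iz] := eqVneq i z.
    rewrite iz /diffX big_ord_recl big1 => [|j _]; last by rewrite bin0n mulr0 mul0r.
    by rewrite /= addr0 mul1r bin0n mul1r addr0 expr1n oner_eq0.
  rewrite diffXn ?mulf_eq0 ?signr_eq0 ?pnatr_eq0 -?lt0n ?fact_gt0 //.
    by rewrite eqn0Ngt fact_gt0.
  by have := aK i; rewrite /a (negPf iz).
move=> m' /andP[m'q ne].
have [lt|le] := ltnP (m' z) (m z).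
  by rewrite IHl ?mul0r //; lia.
(* The degrees of [m] and [m'] agree, so [m z <= m' z] and [m' != m] force a smaller exponent in
   another direction, where the difference kills [m']. *)
suff [i iz lt] : exists2 i, i != z & (m' i < m i)%N.
  by rewrite (bigD1 i) //= diffX_eq0 ?mul0r ?mulr0 // aK /a (negPf iz) lt.
apply/exists_inP; apply: contraR ne => /exists_inPn ge.
have {}ge i : (m i <= m' i)%N.
  by have [->//|iz] := eqVneq i z; rewrite leqNgt ge.
rewrite eq_sym; apply/eqP/mnmP => i; apply/eqP.
have := leqif_sum (fun i (_ : true) => leqif_eq (ge i)).
rewrite -!mdegE md (qd m' m'q) => -[_]; rewrite eqxx => /esym/forallP; exact.
Qed.

End FiniteDifferences.
Arguments evn {R n}.
Arguments evn_ext {R n}.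
Arguments fdcoef R {n K}.

(** If [mu] is the largest leading monomial of the [f i], the coefficient of [mu + mu] in [g] is a
    sum of squares, not all zero, so [mu] cannot have degree above [d]. *)
Lemma sos_msize {R : realType} {n d m : nat} {g : {mpoly R[n]}} {f : 'I_m -> {mpoly R[n]}} :
  g \is (2 * d).-homog -> g = \sum_(i < m) f i ^+ 2 ->
  forall i, (msize (f i) <= d.+1)%N.
Proof.
move=> /dhomogP gd gE i; rewrite leqNgt; apply/negP => lt.
have [j _ jmax] := @arg_maxP _ _ _ i xpredT (fun i => mlead (f i)) isT.
have degj : (d < mdeg (mlead (f j)))%N.
  have fi0 : f i != 0 by apply: contraTneq lt => ->; rewrite msize0.
  by have /lemc_mdeg := jmax i isT; apply: leq_trans; rewrite -ltnS mlead_deg.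
have fj0 : f j != 0 by apply: contraTneq degj => ->; rewrite mlead0 mdeg0.
set mu := mlead (f j) in jmax degj.
suff : g@_(mu + mu)%MM != 0.
  rewrite -mcoeff_msupp => /gd; rewrite [LHS]mdegD => degmu.
  move: (mdeg mu) degj degmu => e; lia.
have sq k : (f k ^+ 2)@_(mu + mu)%MM = (f k)@_mu ^+ 2.
  by rewrite !expr2 mleadcMW //; apply: (jmax k).
rewrite gE linear_sum /= psumr_neq0 => [|k _]; last by rewrite sq sqr_ge0.
apply/hasP; exists j; rewrite ?mem_index_enum //= sq.
by rewrite lt_neqAle sqr_ge0 eq_sym sqrf_eq0 mleadc_eq0 fj0.
Qed.

(** * Estimates between sums of squares over parts of the grid *)

Section Grid.

Variables (R : realType) (n N : nat) (A : pred 'I_n).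
Implicit Types (f : {mpoly R[n]}) (y z c : 'I_n -> nat) (P : pred {ffun 'I_n -> 'I_N}).

Definition level z := (\sum_(i | A i) z i)%N.

(** Only the coordinates in [A] run over the grid; the others, the homogenizing one among them, stay
    frozen at [c]. *)
Definition patch c z : 'I_n -> nat := fun i => if A i then z i else c i.

Definition level_le k : pred {ffun 'I_n -> 'I_N} := fun t => (level (fun i => t i) <= k)%N.

Definition grid_sum P (q : {mpoly R[n]}) c : R :=
  \sum_(t | P t) evn q (patch c (fun i => t i)).

(** The constant comes before [f] and [c], so that it serves all the squares of a decomposition at
    once. *)
Definition dominated d P (phi : {mpoly R[n]} -> ('I_n -> nat) -> R) :=
  exists C : R, forall f c, (msize f <= d.+1)%N ->
    phi f c ^+ 2 <= C * grid_sum P (f ^+ 2) c.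

Lemma evnX2 f y : evn (f ^+ 2) y = evn f y ^+ 2.
Proof. by rewrite /evn rmorphXn. Qed.

Lemma grid_sum_sq_ge0 P f c : 0 <= grid_sum P (f ^+ 2) c.
Proof. by apply: sumr_ge0 => t _; rewrite evnX2 sqr_ge0. Qed.

Lemma dominated_ge0 d P phi : dominated d P phi ->
  exists2 C : R, 0 <= C & forall f c, (msize f <= d.+1)%N ->
    phi f c ^+ 2 <= C * grid_sum P (f ^+ 2) c.
Proof.
move=> [C domC]; exists `|C| => // f c fd; apply: le_trans (domC f c fd) _.
by rewrite ler_wpM2r ?ler_norm // grid_sum_sq_ge0.
Qed.

Lemma dominated_sum d P (I : Type) (r : seq I) (Q : pred I) phi :
  (forall i, Q i -> dominated d P (phi i)) ->
  dominated d P (fun f c => \sum_(i <- r | Q i) phi i f c).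
Proof.
move=> dom; elim: r => [|i r [C domC]].
  by exists 0 => f c _; rewrite big_nil mul0r expr0n.
case: (boolP (Q i)) => [Qi|nQi]; last first.
  by exists C => f c fd; rewrite big_cons (negPf nQi) domC.
have [C' domC'] := dom i Qi; exists (2 * C' + 2 * C) => f c fd.
rewrite big_cons Qi; have := domC f c fd; have := domC' f c fd.
set u := phi i f c; set v := \sum_(i <- r | Q i) _; set S := grid_sum _ _ _.
by have := sqr_ge0 (u - v); nra.
Qed.

Lemma dominatedZ d P w phi : dominated d P phi -> dominated d P (fun f c => w * phi f c).
Proof.
move=> [C domC]; exists (w ^+ 2 * C) => f c fd.
by rewrite exprMn -mulrA ler_wpM2l ?sqr_ge0 ?domC.
Qed.

Lemma dominated_grid d P (t : {ffun 'I_n -> 'I_N}) z : P t ->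
  (forall i, A i -> z i = t i) -> dominated d P (fun f c => evn f (patch c z)).
Proof.
move=> Pt zt; exists 1 => f c _; rewrite mul1r /grid_sum (bigD1 t) //= evnX2.
rewrite (evn_ext _ (patch c (fun i => t i)) (patch c z)).
  by rewrite lerDl sumr_ge0 // => s _; rewrite evnX2 sqr_ge0.
by move=> i; rewrite /patch; case: ifP => // /zt.
Qed.

Lemma dominated_ext d P phi psi : (forall f c, (msize f <= d.+1)%N -> phi f c = psi f c) ->
  dominated d P phi -> dominated d P psi.
Proof. by move=> e [C domC]; exists C => f c fd; rewrite -e // domC. Qed.

(* A finite difference of order larger than the degree vanishes, so its value at
   one vertex is a combination of the values at the other vertices. *)
Lemma dominated_step d P y a (e : 'I_n -> nat) :
  (d < level a)%N -> (forall i, A i -> e i <= a i)%N ->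
  (forall b, (forall i, A i -> b i <= a i)%N -> (exists2 i, A i & b i != e i) ->
     dominated d P (fun f c => evn f (patch c (fun i => y i + b i)%N))) ->
  dominated d P (fun f c => evn f (patch c (fun i => y i + e i)%N)).
Proof.
(* Order 0 outside [A] keeps the differences within the grid directions. *)
move=> da ea dom; pose a' i := if A i then a i else 0%N.
pose K := (level a).+1.
have a'K i : (a' i < K)%N.
  by rewrite /a' /K; case: ifP => // Ai; rewrite ltnS /level (bigD1 i) //= leq_addr.
pose e0 : {ffun 'I_n -> 'I_K} := [ffun i => inord (if A i then e i else 0%N)].
have e0E i : e0 i = (if A i then e i else 0%N) :> nat.
  rewrite ffunE inordK //; case: ifP => // Ai.
  by apply: leq_ltn_trans (a'K i); rewrite /a' Ai ea.
have e0a : fdcoef R a' e0 != 0.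
  rewrite fdcoef_neq0; apply/forallP => i; rewrite e0E /a'; case: ifP => //; exact: ea.
have patchD c z (b : {ffun 'I_n -> 'I_K}) : fdcoef R a' b != 0 ->
    (fun i => patch c z i + b i)%N =1 patch c (fun i => z i + b i)%N.
  rewrite fdcoef_neq0 => /forallP ba i; have := ba i.
  by rewrite /patch /a'; case: ifP => // _; rewrite leqn0 => /eqP ->; rewrite addn0.
(* The vanishing difference solved for the value at [e0]. Dropping the zero coefficients leaves only
   vertices of the box, where [dom] applies. *)
pose psi f c := - (fdcoef R a' e0)^-1 *
   \sum_(b : {ffun 'I_n -> 'I_K} | (b != e0) && (fdcoef R a' b != 0))
      fdcoef R a' b * evn f (patch c (fun i => y i + b i)%N).
apply: (@dominated_ext _ _ psi) => [f c fd|].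
  have a'sum : (\sum_i a' i = level a)%N by rewrite /level [RHS]big_mkcond.
  have := fd_eq0 R n K a' f (patch c y) a'K.
  rewrite a'sum => /(_ (leq_trans fd da)); rewrite (bigD1 e0) //=.
  rewrite (evn_ext _ _ _ (patchD c y e0 e0a)).
  rewrite (evn_ext _ (patch c (fun i => y i + e0 i)%N)
                     (patch c (fun i => y i + e i)%N)); last first.
    by move=> i; rewrite /patch; case: ifP => // Ai; rewrite e0E Ai.
  rewrite (bigID (fun b => fdcoef R a' b != 0)) /= [X in _ + (_ + X)]big1 => [|b]; last first.
    by rewrite negbK => /andP[_ /eqP->]; rewrite mul0r.
  rewrite addr0 => /eqP; rewrite addr_eq0 => /eqP e0f; rewrite /psi.
  apply: (mulfI e0a); rewrite e0f mulNr mulrN mulVKf //; congr (- _).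
  by apply: eq_bigr => b /andP[_ nz]; rewrite (evn_ext _ _ _ (patchD c y b nz)).
apply: dominatedZ; apply: dominated_sum => b /andP[be nz]; apply: dominatedZ.
have ba i : A i -> (b i <= a i)%N.
  by move=> Ai; move: nz; rewrite fdcoef_neq0 => /forallP/(_ i); rewrite /a' Ai.
apply: dom => //; apply/exists_inP; apply: contraR be => /exists_inPn eqb.
apply/eqP/ffunP => i; apply: val_inj; rewrite /= e0E; case: ifP => Ai.
  by have := eqb i Ai; rewrite negbK => /eqP.
by move: nz; rewrite fdcoef_neq0 => /forallP/(_ i); rewrite /a' Ai leqn0 => /eqP.
Qed.

Lemma level_lt b a : (forall i, A i -> b i <= a i)%N -> (exists2 i, A i & b i != a i) ->
  (level b < level a)%N.
Proof.
move=> ba [i Ai ne]; rewrite /level (bigD1 i) //= [ltnRHS](bigD1 i) //=.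
rewrite -addSn leq_add ?leq_sum //; first by rewrite ltn_neqAle ne ba.
by move=> j /andP[Aj _]; apply: ba.
Qed.

Lemma levelD y z : level (fun i => y i + z i)%N = (level y + level z)%N.
Proof. exact: big_split. Qed.

(** Induction on the level: above level [k], [z] is the top vertex of the box from the origin to
    [z], and the other vertices have smaller level. *)
Lemma dominated_low k z : (k < N)%N ->
  dominated k (level_le k) (fun f c => evn f (patch c z)).
Proof.
move=> kN; have [l] := ubnP (level z); elim: l z => // l IHl z zl.
have [zk|kz] := leqP (level z) k.
  have zN i : A i -> (z i < N)%N.
    move=> Ai; apply: leq_ltn_trans kN; apply: leq_trans zk.
    by rewrite /level (bigD1 i) //= leq_addr.
  have N0 : (0 < N)%N by apply: leq_ltn_trans kN.
  pose t : {ffun 'I_n -> 'I_N} := [ffun i => insubd (Ordinal N0) (z i)].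
  have tz i : A i -> z i = t i by move=> Ai; rewrite ffunE val_insubd zN.
  apply: (@dominated_grid _ _ t) => //; apply: leq_trans zk.
  by rewrite /level (eq_bigr z) // => i /tz.
have := @dominated_step k (level_le k) (fun=> 0%N) z z kz.
apply=> // b bz ne; apply: IHl; rewrite levelD /level big1 // add0n.
exact: leq_trans (level_lt _ _ bz ne) _.
Qed.

(** Downward induction on the level: at level at most [k], [z] is the bottom vertex of the box up to
    the corner [N.-1], whose total order [#|A| * N.-1 - level z] exceeds [d]; the other vertices
    have larger level. *)
Lemma dominated_high k d z : (d + k < #|A| * N.-1)%N -> (forall i, A i -> z i < N)%N ->
  dominated d (predC (level_le k)) (fun f c => evn f (patch c z)).
Proof.
move=> dk; have [l] := ubnP (#|A| * N.-1 - level z)%N; elim: l z => // l IHl z zl zN.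
have [zk|kz] := leqP (level z) k; last first.
  have N0 : (0 < N)%N by rewrite lt0n; apply: contraTneq dk => ->; rewrite muln0.
  pose t : {ffun 'I_n -> 'I_N} := [ffun i => insubd (Ordinal N0) (z i)].
  have tz i : A i -> z i = t i by move=> Ai; rewrite ffunE val_insubd zN.
  apply: (@dominated_grid _ _ t) => //=; rewrite /level_le -ltnNge.
  by rewrite /level (eq_bigr z) // => i /tz.
have top : (level z + level (fun i => N.-1 - z i) = #|A| * N.-1)%N.
  rewrite -levelD /level -sum_nat_const; apply: eq_bigr => i Ai.
  by rewrite subnKC // -ltnS prednK ?zN // (leq_ltn_trans _ (zN i Ai)).
apply: (@dominated_ext _ _ (fun f c => evn f (patch c (fun i => z i + 0)%N))).
  by move=> f c _; apply: evn_ext => i; rewrite /patch addn0.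
have := @dominated_step d (predC (level_le k)) z (fun i => N.-1 - z i)%N (fun=> 0%N).
apply=> //; first by lia.
move=> b bz [i Ai b0]; apply: IHl => [|j Aj]; last first.
  by have := bz j Aj; have := zN j Aj; lia.
have : (0 < level b)%N by rewrite /level (bigD1 i) //= addn_gt0 lt0n b0.
have : (level b <= level (fun i => N.-1 - z i))%N by apply: leq_sum => j; apply: bz.
by rewrite levelD; lia.
Qed.

Definition sum_dominated d P Q := exists2 C : R, 0 <= C &
  forall f c, (msize f <= d.+1)%N -> grid_sum P (f ^+ 2) c <= C * grid_sum Q (f ^+ 2) c.

Lemma grid_sum_dominated d P Q :
  (forall t : {ffun 'I_n -> 'I_N}, P t ->
     dominated d Q (fun f c => evn f (patch c (fun i => t i)))) ->
  sum_dominated d P Q.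
Proof.
move=> dom; rewrite /sum_dominated {1}/grid_sum.
elim: (index_enum _) => [|t r [C C0 domC]].
  by exists 0 => // f c _; rewrite big_nil mul0r.
case: (boolP (P t)) => [Pt|nPt]; last first.
  by exists C => // f c fd; rewrite big_cons (negPf nPt) domC.
have [C' C'0 domC'] := dominated_ge0 _ _ _ (dom t Pt).
exists (C' + C) => [|f c fd]; first exact: addr_ge0.
by rewrite big_cons Pt mulrDl lerD ?domC // evnX2 domC'.
Qed.

End Grid.

(** * Positivity of the dehomogenized form *)

Section Positivity.

Variable R : realType.

Definition window (a N : nat) (t : R) : R := \prod_(j < 2 * N) (t - (a + j)%:R).

Lemma window_ge0 a N (t : R) : t <= a%:R \/ (a + 2 * N)%:R <= t + 1 -> 0 <= window a N t.
Proof.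
case=> ta; last first.
  apply: prodr_ge0 => j _; move: ta; rewrite !(natrD _ a).
  have : j%:R + 1 <= (2 * N)%:R :> R by rewrite natr1 ler_nat.
  lra.
have -> : window a N t = \prod_(j < 2 * N) - ((a + j)%:R - t).
  by apply: eq_bigr => j _; rewrite opprB.
rewrite prodrN card_ord exprM sqrrN expr1n expr1n mul1r; apply: prodr_ge0 => j _.
by rewrite subr_ge0 (le_trans ta) // ler_nat leq_addr.
Qed.

Definition window_bound N : R := (2 * N)%:R ^+ (2 * N).

(** Between the extreme zeros each factor is at most [2 * N] in absolute value. Partial products are
    covered so that one factor can be kept apart in the estimate near a zero. *)
Lemma window_norm a N (t : R) (P : pred 'I_(2 * N)) : a%:R <= t -> t + 1 <= (a + 2 * N)%:R ->
  \prod_(j | P j) `|t - (a + j)%:R| <= window_bound N.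
Proof.
move=> at_ tb; have N1 (j : 'I_(2 * N)) : 1 <= (2 * N)%:R :> R.
  by rewrite ler1n (leq_ltn_trans _ (ltn_ord j)).
have -> : window_bound N = \prod_(j < 2 * N) (2 * N)%:R by rewrite prodr_const card_ord.
rewrite [leRHS](bigID P) /= -[leLHS]mulr1; apply: ler_pM; first exact: prodr_ge0.
- exact: ler01.
- apply: ler_prod => j _; rewrite normr_ge0 /=.
  have jN : j%:R + 1 <= (2 * N)%:R :> R by rewrite natr1 ler_nat.
  have j0 := ler0n R j; move: tb; clear N1; rewrite ler_norml !(natrD _ a); lra.
- by elim/big_rec: _ => // j u _ u1; apply: mulr_ege1 => //; exact: (N1 j).
Qed.

Lemma window_ge a N (t : R) : - window_bound N <= window a N t.
Proof.
have K0 : 0 <= window_bound N by rewrite exprn_ge0.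
have [ta|at_] := leP t a%:R.
  by apply: le_trans (window_ge0 _ _ _ (or_introl ta)); rewrite oppr_le0.
have [tb|bt] := leP (a + 2 * N)%:R (t + 1).
  by apply: le_trans (window_ge0 _ _ _ (or_intror tb)); rewrite oppr_le0.
have := window_norm a N t xpredT (ltW at_) (ltW bt).
by rewrite -normr_prod ler_norml => /andP[].
Qed.

(* Below [a] the product is nonnegative, and its integer zeros make it small. *)
Lemma window_ge_dist a N (t : R) (s : nat) : (s < a + 2 * N)%N ->
  - (window_bound N * `|t - s%:R|) <= window a N t.
Proof.
move=> sN; have K0 : 0 <= window_bound N by rewrite exprn_ge0.
have [ta|at_] := leP t a%:R.
  apply: le_trans (window_ge0 _ _ _ (or_introl ta)).
  by rewrite oppr_le0 mulr_ge0.
have [tb|bt] := leP (a + 2 * N)%:R (t + 1).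
  apply: le_trans (window_ge0 _ _ _ (or_intror tb)).
  by rewrite oppr_le0 mulr_ge0.
suff near (j0 : 'I_(2 * N)) : - (window_bound N * `|t - (a + j0)%:R|) <= window a N t.
  have [sa|as_] := leqP a s.
    have sj : (s - a < 2 * N)%N by lia.
    by have := near (Ordinal sj); rewrite /= subnKC.
  have N0 : (0 < 2 * N)%N by case: (N) bt => // ; rewrite addn0; lra.
  (* For [s < a < t] the zero [a] is closer to [t] than [s] is. *)
  apply: le_trans (near (Ordinal N0)); rewrite lerN2 ler_wpM2l //= addn0.
  have : s%:R <= a%:R :> R by rewrite ler_nat ltnW.
  by move=> sa; rewrite !ger0_norm; lra.
have := window_norm a N t (fun j => j != j0) (ltW at_) (ltW bt).
rewrite /window -normr_prod => le; set u := (X in _ <= X).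
have -> : u = (t - (a + j0)%:R) * \prod_(j < 2 * N | j != j0) (t - (a + j)%:R).
  by rewrite /u (bigD1 j0).
rewrite lerNl -mulrN; apply: le_trans (ler_norm _) _.
by rewrite mulrN normrN normrM mulrC ler_wpM2r.
Qed.

(** If every [x i] with [i] in [A] is within [del] of a node, their sum is close to an integer below
    [a + 2 * N], and [window] is at least [- eps]. Otherwise some [x i] is far from all nodes, and
    its product of squares, times [M], outweighs the global lower bound of [window]. *)
Lemma grid_form_pos n (A : pred 'I_n) (a N : nat) (eps : R) :
  (#|A| * N.-1 < a + 2 * N)%N -> (0 < N)%N -> 0 < eps ->
  exists2 M : R, 0 <= M & forall x : 'I_n -> R,
    0 <= M * \sum_(i | A i) \prod_(j < N) (x i - j%:R) ^+ 2
         + window a N (\sum_(i | A i) x i) + eps.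
Proof.
move=> AN N0 eps0; set K := window_bound N.
have K0 : 0 < K by rewrite exprn_gt0 // ltr0n; lia.
(* Chosen so that [K * #|A| * del <= eps], the successor covering an empty [A]; [M] is then chosen
   with [M * del ^+ (2 * N) = K]. *)
pose del := eps / (K * (#|A|.+1)%:R).
have del0 : 0 < del by rewrite divr_gt0 // mulr_gt0.
have M0 : 0 <= K / del ^+ (2 * N) by rewrite divr_ge0 ?exprn_ge0 // ltW.
exists (K / del ^+ (2 * N)) => // x.
have F0 i : 0 <= \prod_(j < N) (x i - j%:R) ^+ 2 by apply: prodr_ge0 => j _; exact: sqr_ge0.
have [near|far] := boolP [forall i, A i ==> [exists j : 'I_N, `|x i - j%:R| <= del]].
  pose s i : nat := odflt (Ordinal N0) [pick j : 'I_N | `|x i - j%:R| <= del].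
  have sP i : A i -> `|x i - (s i)%:R| <= del.
    move=> Ai; have /implyP/(_ Ai)/existsP[j jd] := forallP near i.
    by rewrite /s; case: pickP => [//|/(_ j)]; rewrite jd.
  have := @window_ge_dist a N (\sum_(i | A i) x i) (\sum_(i | A i) s i)%N.
  rewrite -/K natr_sum -sumrB => /(_ _)/wrap[].
    apply: leq_ltn_trans AN; rewrite -sum_nat_const; apply: leq_sum => i _.
    by rewrite -ltnS prednK // /s ltn_ord.
  move=> lo; have : `|\sum_(i | A i) (x i - (s i)%:R)| <= #|A|%:R * del.
    apply: le_trans (ler_norm_sum _ _ _) _.
    by rewrite mulr_natl -sumr_const; apply: ler_sum => i /sP.
  rewrite -(ler_pM2l K0) => hi.
  have Kd : K * (#|A|%:R * del) <= eps.
    have -> : K * (#|A|%:R * del) = eps * (#|A|%:R / #|A|.+1%:R).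
      rewrite /del; field.
      by rewrite (gt_eqF K0) andbT addrC natr1 pnatr_eq0.
    rewrite ler_piMr //; first exact: ltW.
    by rewrite ler_pdivrMr ?ltr0Sn // mul1r ler_nat.
  have MF0 : 0 <= K / del ^+ (2 * N) * \sum_(i | A i) \prod_(j < N) (x i - j%:R) ^+ 2.
    by rewrite mulr_ge0 // sumr_ge0.
  move: lo hi Kd MF0; clear; lra.
move: far => /forallPn[i]; rewrite negb_imply => /andP[Ai /existsPn far].
have Fi : del ^+ (2 * N) <= \sum_(i | A i) \prod_(j < N) (x i - j%:R) ^+ 2.
  rewrite (bigD1 i) //= -[leLHS]addr0; apply: lerD; last exact: sumr_ge0.
  have -> : del ^+ (2 * N) = \prod_(j < N) del ^+ 2 by rewrite prodr_const card_ord exprM.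
  apply: ler_prod => j _.
  rewrite sqr_ge0 -[leRHS]real_normK ?num_real //= lerXn2r ?nnegrE //; first exact: ltW.
  by rewrite ltW // ltNge far.
have := window_ge a N (\sum_(i | A i) x i); rewrite -/K.
have : K <= K / del ^+ (2 * N) * \sum_(i | A i) \prod_(j < N) (x i - j%:R) ^+ 2.
  by rewrite mulrAC ler_pdivlMr ?exprn_gt0 // ler_wpM2l // ltW.
lra.
Qed.

End Positivity.

Lemma window_ge1 {R : realType} k N (w : nat) : (w <= k)%N -> 1 <= window R k.+1 N w%:R.
Proof.
move=> wk; have -> : window R k.+1 N w%:R = \prod_(j < 2 * N) - ((k.+1 + j)%:R - w%:R).
  by apply: eq_bigr => j _; rewrite opprB.
rewrite prodrN card_ord exprM sqrrN expr1n expr1n mul1r.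
elim/big_rec: _ => // j u _ u1; apply: mulr_ege1 => //.
by rewrite -natrB ?ler1n; lia.
Qed.

Lemma window_eq0 {R : realType} k N (w : nat) : (k < w <= k + 2 * N)%N -> window R k.+1 N w%:R = 0.
Proof.
move=> /andP[kw wN]; have wj : (w - k.+1 < 2 * N)%N by lia.
by rewrite /window (bigD1 (Ordinal wj)) //= subnKC // subrr mul0r.
Qed.

Lemma dhomog_prod_const {R : realType} {n d N : nat} (F : 'I_N -> {mpoly R[n]}) :
  (forall j, F j \is d.-homog) -> \prod_(j < N) F j \is (d * N).-homog.
Proof.
elim: N F => [|N IHN] F Fd; first by rewrite big_ord0 muln0 dhomog1.
by rewrite big_ord_recl mulnS dhomogM // IHN.
Qed.

(** * The form and its values on the grid *)

Section GridForm.

Variables (R : realType) (n N k : nat) (A : pred 'I_n) (z : 'I_n).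

Definition grid_form (M eps : R) : {mpoly R[n]} :=
  M *: \sum_(i | A i) \prod_(j < N) ('X_i - j%:R *: 'X_z) ^+ 2
  + \prod_(j < 2 * N) (\sum_(i | A i) 'X_i - (k.+1 + j)%:R *: 'X_z)
  + eps *: 'X_z ^+ (2 * N).

Lemma grid_form_homog M eps : grid_form M eps \is (2 * N).-homog.
Proof.
have X1 i : 'X_i \is [in R[n], 1.-homog] by rewrite dhomogX; apply/eqP; exact: mdeg1.
have XZ1 (c : R) : c *: 'X_z \is 1.-homog by apply: dhomogZ.
have F2 i : \prod_(j < N) ('X_i - j%:R *: 'X_z) ^+ 2 \is [in R[n], (2 * N).-homog].
  apply: dhomog_prod_const => j; apply: (@dhomogMn _ _ _ 1); exact: rpredB.
have W1 : \prod_(j < 2 * N) (\sum_(i | A i) 'X_i - (k.+1 + j)%:R *: 'X_z) \is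
    [in R[n], (1 * (2 * N)).-homog].
  by apply: dhomog_prod_const => j; apply: rpredB => //; apply: rpred_sum.
have Z1 : 'X_z ^+ (2 * N) \is [in R[n], (1 * (2 * N)).-homog] by apply: dhomogMn.
rewrite mul1n in W1 Z1.
apply: dhomogD; last exact: dhomogZ; apply: dhomogD => //; apply: dhomogZ.
by apply: rpred_sum => i _; exact: F2.
Qed.

Lemma meval_grid_form M eps (x : 'I_n -> R) : (grid_form M eps).@[x] =
  M * \sum_(i | A i) \prod_(j < N) (x i - j%:R * x z) ^+ 2
  + \prod_(j < 2 * N) (\sum_(i | A i) x i - (k.+1 + j)%:R * x z)
  + eps * x z ^+ (2 * N).
Proof.
rewrite /grid_form !mevalD !mevalZ !rmorph_sum !rmorph_prod rmorphXn /= mevalXU.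
congr (_ * _ + _ + _).
  apply: eq_bigr => i _; rewrite rmorph_prod; apply: eq_bigr => j _.
  by rewrite rmorphXn /= mevalB mevalZ !mevalXU.
apply: eq_bigr => j _; rewrite mevalB mevalZ rmorph_sum /= mevalXU.
by congr (_ - _); apply: eq_bigr => i _; rewrite mevalXU.
Qed.

Hypothesis AN : (#|A| * N.-1 <= 2 * N + k)%N.
Hypothesis N0 : (0 < N)%N.

(** Where [x z] is nonzero, the even power [x z ^+ (2 * N)] factors out and the affine bound
    applies. Where it is zero, the middle product is an even power of the coordinate sum. *)
Lemma grid_form_ge0 eps : 0 < eps ->
  exists M, forall x : 'I_n -> R, 0 <= (grid_form M eps).@[x].
Proof.
move=> eps0.
have AN' : (#|A| * N.-1 < k.+1 + 2 * N)%N by lia.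
have [M M0 pos] := @grid_form_pos R n A k.+1 N eps AN' N0 eps0.
exists M => x; rewrite meval_grid_form.
have [z0|z0] := eqVneq (x z) 0.
  rewrite z0; apply: addr_ge0; first apply: addr_ge0.
  - rewrite mulr_ge0 // sumr_ge0 // => i _; apply: prodr_ge0 => j _; exact: sqr_ge0.
  - under eq_bigr do rewrite mulr0 subr0.
    by rewrite prodr_const card_ord exprM exprn_ge0 ?sqr_ge0.
  - by rewrite mulr_ge0 ?exprn_ge0 // ltW.
have scale c u : u - c * x z = x z * (u / x z - c) by field.
have -> : \sum_(i | A i) \prod_(j < N) (x i - j%:R * x z) ^+ 2 =
    x z ^+ (2 * N) * \sum_(i | A i) \prod_(j < N) (x i / x z - j%:R) ^+ 2.
  rewrite mulr_sumr; apply: eq_bigr => i _.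
  under eq_bigr do rewrite scale exprMn.
  by rewrite big_split prodr_const card_ord exprM.
under [X in _ + X + _]eq_bigr do rewrite scale.
rewrite big_split prodr_const card_ord /= mulrCA [eps * _]mulrC -!mulrDr mulr_ge0 //.
  by rewrite exprM exprn_ge0 // sqr_ge0.
by rewrite mulr_suml; exact: pos.
Qed.

Lemma evn_grid_form M eps c (t : {ffun 'I_n -> 'I_N}) : ~~ A z -> c z = 1%N ->
  evn (grid_form M eps) (patch n A c (fun i => t i)) =
  window R k.+1 N (level n A (fun i => t i))%:R + eps.
Proof.
move=> nAz cz; rewrite /evn meval_grid_form /patch (negPf nAz) cz expr1n mulr1.
rewrite big1 ?mulr0 ?add0r => [|i Ai]; last first.
  (* The coordinate [t i] is itself one of the nodes, so a factor vanishes. *)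
  by rewrite (bigD1 (t i)) //= Ai mulr1 subrr expr0n mul0r.
congr (_ + _); apply: eq_bigr => j _; rewrite mulr1 /level natr_sum.
by congr (_ - _); apply: eq_bigr => i ->.
Qed.

End GridForm.

(** * Nonexistence of multipliers *)

Lemma sum_dominated_sos {R : realType} {n N A d P Q} (C : R) m (f : 'I_m -> {mpoly R[n]}) c :
  (forall f c, (msize f <= d.+1)%N ->
     grid_sum R n N A P (f ^+ 2) c <= C * grid_sum R n N A Q (f ^+ 2) c) ->
  (forall i, msize (f i) <= d.+1)%N ->
  grid_sum R n N A P (\sum_(i < m) f i ^+ 2) c
    <= C * grid_sum R n N A Q (\sum_(i < m) f i ^+ 2) c.
Proof.
move=> dom fd.
have E P' : grid_sum R n N A P' (\sum_(i < m) f i ^+ 2) c =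
    \sum_(i < m) grid_sum R n N A P' (f i ^+ 2) c.
  by rewrite /grid_sum [RHS]exchange_big; apply: eq_bigr => t _; rewrite /evn rmorph_sum.
by rewrite !E mulr_sumr; apply: ler_sum => i _; apply: dom.
Qed.

(** The lower bound on [#|A| * N.-1] makes the differences long enough for degree [N + k]; the upper
    bound keeps all levels above [k] among the [2 * N] zeros of the window. *)
Theorem nonneg_form_without_multiplier (R : realType) (n N k : nat) (A : pred 'I_n) (z : 'I_n) :
  ~~ A z -> (N + k + k < #|A| * N.-1)%N -> (#|A| * N.-1 <= 2 * N + k)%N ->
  exists p : {mpoly R[n]}, nonneg_form N p /\
    forall q : {mpoly R[n]}, sos_form k q -> q != 0 -> ~ is_sos (p * q).
Proof.
move=> nAz lo hi.
have kN : (k < N)%N by lia.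
have N0 : (0 < N)%N by apply: leq_ltn_trans kN.
pose V := level_le n N A k.
have [C1 C10 dom1] : sum_dominated R n N A (N + k) V (predC V).
  by apply: grid_sum_dominated => t _; apply: dominated_high.
have [C2 C20 dom2] : sum_dominated R n N A k (predC V) V.
  by apply: grid_sum_dominated => t _; apply: dominated_low.
(* This gives [C1 * C2 * eps = 1 - eps], so the chain of estimates ends in [Q <= Q - eps * Q]. *)
pose eps := (C1 * C2 + 1)^-1.
have C0 : 0 <= C1 * C2 by apply: mulr_ge0.
have eps0 : 0 < eps by rewrite invr_gt0; lra.
have [M pos] := grid_form_ge0 R n N k A z hi N0 eps eps0.
exists (grid_form R n N k A z M eps); set p := grid_form _ _ _ _ _ _ _ _.
have ph : p \is (2 * N).-homog by apply: grid_form_homog.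
split=> // q [qh [m [h [hh qE]]]] q0 [m' [f fE]].
have fd i : (msize (f i) <= (N + k).+1)%N.
  by apply: (sos_msize _ fE); rewrite mulnDr; apply: dhomogM.
have hd i : (msize (h i) <= k.+1)%N by apply: sos_msize qh qE i.
have q_ge0 y : 0 <= evn q y.
  by rewrite /evn qE rmorph_sum sumr_ge0 // => i _; rewrite rmorphXn sqr_ge0.
suff : q = 0 by apply/eqP.
apply: (homog_evn_eq0 _ _ _ _ z qh) => y yz; apply/eqP; rewrite eq_le q_ge0 andbT.
have level_top (t : {ffun 'I_n -> 'I_N}) : (level n A (fun i => t i) <= k + 2 * N)%N.
  apply: leq_trans (_ : #|A| * N.-1 <= _)%N; last by lia.
  by rewrite -sum_nat_const; apply: leq_sum => i _; rewrite -ltnS prednK.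
have lowV : grid_sum R n N A V q y <= grid_sum R n N A V (p * q) y.
  apply: ler_sum => t Vt; rewrite /evn mevalM -!/(evn _ _) ler_peMl // evn_grid_form //.
  by have := @window_ge1 R k N _ Vt; lra.
have highS : grid_sum R n N A (predC V) (p * q) y = eps * grid_sum R n N A (predC V) q y.
  rewrite /grid_sum mulr_sumr; apply: eq_bigr => t Vt.
  rewrite /evn mevalM -!/(evn _ _) evn_grid_form // window_eq0 ?add0r //.
  by rewrite level_top ltnNge andbT.
have Q0 : grid_sum R n N A V q y <= 0.
  have := sum_dominated_sos C1 m' f y dom1 fd; rewrite -fE highS => le1.
  have := sum_dominated_sos C2 m h y dom2 hd; rewrite -qE => le2.
  have le3 : C1 * (eps * grid_sum R n N A (predC V) q y)
      <= C1 * (eps * (C2 * grid_sum R n N A V q y)).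
    by rewrite ler_wpM2l // ler_wpM2l // ltW.
  have := le_trans lowV (le_trans le1 le3).
  set Q := grid_sum _ _ _ _ _ _ _.
  have -> : C1 * (eps * (C2 * Q)) = Q - eps * Q by rewrite /eps; field; lra.
  by rewrite lerBrDl gerDr pmulr_rle0.
(* Applied to each [h i] and summed, this bounds [q] at any lattice point by its sum over [V]. *)
have [C C0' domC] := dominated_ge0 _ _ _ _ _ _ _ (dominated_low R n N A k y kN).
have -> : evn q y = evn q (patch n A y y) by apply: evn_ext => i; rewrite /patch if_same.
apply: le_trans (_ : C * grid_sum R n N A V q y <= 0); last by rewrite mulr_ge0_le0.
have -> : evn q (patch n A y y) = \sum_(i < m) evn (h i) (patch n A y y) ^+ 2.
  by rewrite /evn qE rmorph_sum; apply: eq_bigr => i _; rewrite rmorphXn.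
apply: le_trans (ler_sum _ (fun i _ => domC (h i) y (hd i))) _.
rewrite -mulr_sumr ler_wpM2l // /grid_sum exchange_big qE /=.
by apply: ler_sum => t _; rewrite /evn rmorph_sum.
Qed.

Theorem corollary2p8 (R : realType) :
  (forall k : nat,
     exists p : {mpoly R[3]}, nonneg_form (2 * k + 3)%N p /\
       forall q : {mpoly R[3]}, sos_form k q -> q != 0 -> ~ is_sos (p * q)) /\
  (exists p : {mpoly R[4]}, nonneg_form 3 p /\
     forall q : {mpoly R[4]}, sos_form 1 q -> q != 0 -> ~ is_sos (p * q)) /\
  (exists p : {mpoly R[7]}, nonneg_form 2 p /\
     forall q : {mpoly R[7]}, sos_form 1 q -> q != 0 -> ~ is_sos (p * q)).
Proof.
(* Coordinate 0 is the homogenizing one, and [A] consists of the coordinates 1 to [m]. *)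
have cardA n m : (m <= n)%N -> #|[pred i : 'I_n.+1 | 0 < i <= m]%N| = m.
  move=> mn; rewrite -sum1_card big_mkcond big_ord_recl /= add0n -[RHS]card_ord -sum1_card.
  rewrite (big_ord_widen n (fun=> 1%N)) // [RHS]big_mkcond /=.
  by apply: eq_bigr => i _; rewrite inE.
split=> [k|]; last split.
(* With [N = 2 * k + 3] the inequalities read [4 * k + 3 < 4 * k + 4 <= 5 * k + 6]. *)
- by apply: (@nonneg_form_without_multiplier R 3 _ k [pred i : 'I_3 | 0 < i <= 2]%N ord0);
    rewrite ?cardA //; lia.
(* With [N = 3] they read [5 < 6 <= 7]. *)
- by apply: (@nonneg_form_without_multiplier R 4 _ 1 [pred i : 'I_4 | 0 < i <= 3]%N ord0);
    rewrite ?cardA.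
(* Five of the six affine variables suffice; with all six, the product of [2N = 4]
   linear factors could not vanish on the five levels 2, .., 6 of [S]. *)
- by apply: (@nonneg_form_without_multiplier R 7 _ 1 [pred i : 'I_7 | 0 < i <= 5]%N ord0);
    rewrite ?cardA.
Qed.
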